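(* Let $x,y\in\mathbb{R}$ be such that $x\neq 0$ and $xy\in\mathbb{Z}$, and let $c\in\mathbb{C}$ with $|c|=1$. Then the operator $\mathrm{Id}+cE_yT_x:L^2(\mathbb{R})\to L^2(\mathbb{R})$ is not surjective.
   Context: For $x,y\in\mathbb{R}$, $E_x$ and $T_y$ are the unitary operators on $L^2(\mathbb{R})$ (complex-valued functions) defined by $(E_xf)(t)=e^{2\pi i xt}f(t)$ and $(T_yf)(t)=f(t-y)$. $\mathrm{Id}$ denotes the identity operator. *)

(* Defs.v *)
From HB Require Import structures.
From mathcomp Require Import all_boot all_order all_algebra.
From mathcomp Require Import generic_quotient ring_quotient.
From mathcomp Require Import all_classical all_reals all_analysis.
From mathcomp Require Import measurable_realfun.
From mathcomp Require Import complex.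
From mathcomp Require Import ring lra.

Set Implicit Arguments.
Unset Strict Implicit.
Unset Printing Implicit Defensive.

Import Order.TTheory GRing.Theory Num.Theory.
Import numFieldNormedType.Exports.

Local Open Scope classical_set_scope.
Local Open Scope ring_scope.
Local Open Scope complex_scope.
Local Open Scope quotient_scope.

Section SquareIntegrable.
Variable R : realType.
Local Notation mu := (@lebesgue_measure R).
Implicit Types f g : R -> R[i].

(* Borel measurability of the real and imaginary parts, i.e. of f : R -> C = R^2.
   Every Lebesgue measurable function is a.e. equal to a Borel measurable one,
   so the quotient [L2] below is the usual L^2(R). *)
Definition cmeasurable f : Prop :=
  measurable_fun [set: R] (fun t => complex.Re (f t)) /\
  measurable_fun [set: R] (fun t => complex.Im (f t)).

(* [normc] is the modulus of a complex number, as an element of [R]. *)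
Definition sqintegrable f : Prop :=
  (\int[mu]_(t in [set: R]) (Normc.normc (f t) ^+ 2)%:E < +oo)%E.

Definition L2_pred : {pred R -> R[i]} :=
  fun f => `[< cmeasurable f /\ sqintegrable f >].

Lemma L2_predP f : reflect (cmeasurable f /\ sqintegrable f) (f \in L2_pred).
Proof. exact: asboolP. Qed.

Lemma normc_sqr (z : R[i]) :
  Normc.normc z ^+ 2 = complex.Re z ^+ 2 + complex.Im z ^+ 2.
Proof. by case: z => a b /=; rewrite sqr_sqrtr// addr_ge0// sqr_ge0. Qed.

Lemma cmeasurable_normc_sqr f : cmeasurable f ->
  measurable_fun [set: R] (fun t => (Normc.normc (f t) ^+ 2)%:E : \bar R).
Proof.
move=> [mRe mIm]; apply/measurable_EFinP.
rewrite (_ : (fun t => _) =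
    (fun t => complex.Re (f t) ^+ 2 + complex.Im (f t) ^+ 2)).
  by apply: measurable_funD; apply: measurable_funX.
by apply/funext => t; rewrite normc_sqr.
Qed.

Lemma cmeasurableM f g : cmeasurable f -> cmeasurable g ->
  cmeasurable (fun t => f t * g t).
Proof.
move=> [f1 f2] [g1 g2]; split.
- rewrite (_ : (fun t => _) = (fun t => complex.Re (f t) * complex.Re (g t) -
      complex.Im (f t) * complex.Im (g t))); last first.
    by apply/funext => t; case: (f t) (g t) => [a b] [c d].
  by apply: measurable_funB; apply: measurable_funM.
- rewrite (_ : (fun t => _) = (fun t => complex.Re (f t) * complex.Im (g t) +
      complex.Im (f t) * complex.Re (g t))); last first.
    by apply/funext => t; case: (f t) (g t) => [a b] [c d].
  by apply: measurable_funD; apply: measurable_funM.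
Qed.

Lemma cmeasurableD f g : cmeasurable f -> cmeasurable g ->
  cmeasurable (fun t => f t + g t).
Proof.
move=> [f1 f2] [g1 g2]; split.
- rewrite (_ : (fun t => _) = (fun t => complex.Re (f t) + complex.Re (g t))).
    exact: measurable_funD.
  by apply/funext => t; case: (f t) (g t) => [a b] [c d].
- rewrite (_ : (fun t => _) = (fun t => complex.Im (f t) + complex.Im (g t))).
    exact: measurable_funD.
  by apply/funext => t; case: (f t) (g t) => [a b] [c d].
Qed.

Lemma cmeasurable_cst (a : R[i]) : cmeasurable (fun=> a).
Proof. by split; exact: measurable_cst. Qed.

Lemma normc_sqrD (z w : R[i]) : Normc.normc (z + w) ^+ 2 <=
  2 * Normc.normc z ^+ 2 + 2 * Normc.normc w ^+ 2.
Proof.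
rewrite !normc_sqr; case: z w => [a b] [c d] /=.
by have := sqr_ge0 (a - c); have := sqr_ge0 (b - d); nra.
Qed.

Lemma L2_pred_submod_closed : submod_closed L2_pred.
Proof.
split.
  apply/L2_predP; split; first exact: cmeasurable_cst.
  rewrite /sqintegrable (eq_integral (cst 0%E)) ?integral0 ?ltry// => t _.
  by rewrite normc_sqr /= expr0n /= addr0.
move=> a f g /L2_predP[mf sf] /L2_predP[mg sg]; apply/L2_predP.
have maf := cmeasurableM (cmeasurable_cst a) mf.
split; first exact: (cmeasurableD maf mg).
have m1 := cmeasurable_normc_sqr mf.
have m2 := cmeasurable_normc_sqr mg.
have h0 (h : R -> R[i]) t : (0 <= (Normc.normc (h t) ^+ 2)%:E)%E.
  by rewrite lee_fin sqr_ge0.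
pose k := 2 * Normc.normc a ^+ 2.
have k0 : 0 <= k by rewrite mulr_ge0// sqr_ge0.
have -> : sqintegrable (a *: f + g) =
  (\int[mu]_(t in [set: R]) (Normc.normc (a * f t + g t) ^+ 2)%:E < +oo)%E by [].
apply: (@le_lt_trans _ _ (\int[mu]_(t in [set: R])
  (k%:E * (Normc.normc (f t) ^+ 2)%:E + 2%:E * (Normc.normc (g t) ^+ 2)%:E))%E).
  apply: ge0_le_integral => //.
  - by move=> t _; exact: (h0 (fun t => a * f t + g t)).
  - exact: (cmeasurable_normc_sqr (cmeasurableD maf mg)).
  - by apply: emeasurable_funD; apply: measurable_funeM.
  - move=> t _; rewrite -!EFinM -EFinD lee_fin.
    apply: le_trans (normc_sqrD _ _) _.
    by rewrite Normc.normcM exprMn mulrA.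
rewrite ge0_integralD//; first last.
- exact: measurable_funeM.
- by move=> t _; rewrite mule_ge0.
- exact: measurable_funeM.
- by move=> t _; rewrite mule_ge0.
rewrite !ge0_integralZl//.
by rewrite lte_add_pinfty// lte_mul_pinfty// lee_fin.
Qed.

HB.instance Definition _ := GRing.isSubmodClosed.Build R[i] (R -> R[i]) L2_pred
  L2_pred_submod_closed.

Record L2fun := MkL2fun {
  L2fun_val :> R -> R[i];
  L2fun_mem : L2fun_val \in L2_pred }.

HB.instance Definition _ := [isSub for L2fun_val].
HB.instance Definition _ := [Choice of L2fun by <:].
HB.instance Definition _ := [SubChoice_isSubLmodule of L2fun by <:].

Definition L2null : {pred L2fun} :=
  fun f : L2fun => `[< (f : R -> R[i]) = (fun=> 0) %[ae mu] >].

Lemma L2nullP (f : L2fun) :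
  reflect ((f : R -> R[i]) = (fun=> 0) %[ae mu]) (f \in L2null).
Proof. exact: asboolP. Qed.

Lemma L2null_zmod_closed : zmod_closed L2null.
Proof.
split; first by apply/L2nullP/aeW.
move=> f g /L2nullP f0 /L2nullP g0; apply/L2nullP.
apply: (@filterS2 _ _ (ae_filter_ringOfSetsType mu)) f0 g0.
by move=> t /(_ I) ft /(_ I) gt _; rewrite /= -[LHS]/(f t - g t) ft gt subr0.
Qed.

HB.instance Definition _ := GRing.isZmodClosed.Build L2fun L2null
  L2null_zmod_closed.

(* L^2(R), complex-valued: square-integrable functions modulo those that vanish
   almost everywhere. *)
Definition L2 : Type := Quotient.quot L2null.
HB.instance Definition _ := EqQuotient.on L2.
HB.instance Definition _ := GRing.Zmodule.on L2.

Definition L2class (f : L2fun) : L2 := \pi_L2 f.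

Lemma L2class_eqP (f g : L2fun) :
  L2class f = L2class g <-> (f : R -> R[i]) = (g : R -> R[i]) %[ae mu].
Proof.
have fgE : L2class f = L2class g <-> f - g \in L2null.
  split=> [/eqP|fg]; first by rewrite Quotient.idealrBE.
  by apply/eqP; rewrite -Quotient.idealrBE.
split=> [/fgE/L2nullP|fg].
  apply: (@filterS _ _ (ae_filter_ringOfSetsType mu)) => t /(_ I) fgt _.
  by apply/eqP; rewrite -subr_eq0; apply/eqP.
apply/fgE/L2nullP.
apply: (@filterS _ _ (ae_filter_ringOfSetsType mu)) fg => t /(_ I) fgt _.
by rewrite /= -[LHS]/(f t - g t) fgt subrr.
Qed.

Lemma L2class_repr (u : L2) : L2class (repr u) = u.
Proof. exact: reprK. Qed.

Lemma repr_L2class (f : L2fun) :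
  (repr (L2class f) : R -> R[i]) = (f : R -> R[i]) %[ae mu].
Proof. by apply/L2class_eqP; rewrite L2class_repr. Qed.

Lemma L2classD (f g : L2fun) : L2class (f + g) = L2class f + L2class g.
Proof. exact: pi_addr. Qed.

Definition L2scale (a : R[i]) (u : L2) : L2 := L2class (a *: repr u).

Lemma L2scale_class a (f : L2fun) : L2scale a (L2class f) = L2class (a *: f).
Proof.
apply/L2class_eqP.
apply: (@filterS _ _ (ae_filter_ringOfSetsType mu)) (repr_L2class f).
by move=> t /(_ I) ft _; rewrite /= -[LHS]/(a * repr (L2class f) t) ft.
Qed.

Lemma L2scaleA a b u : L2scale a (L2scale b u) = L2scale (a * b) u.
Proof. by rewrite L2scale_class scalerA. Qed.

Lemma L2scale1 : left_id 1 L2scale.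
Proof. by move=> u; rewrite /L2scale scale1r L2class_repr. Qed.

Lemma L2scaleDr : right_distributive L2scale +%R.
Proof.
move=> a u v; rewrite -[u]L2class_repr -[v]L2class_repr -L2classD.
by rewrite !L2scale_class scalerDr L2classD.
Qed.

Lemma L2scaleDl u : {morph L2scale^~ u : a b / a + b}.
Proof. by move=> a b; rewrite /L2scale scalerDl L2classD. Qed.

HB.instance Definition _ := GRing.Zmodule_isLmodule.Build R[i] L2
  L2scaleA L2scale1 L2scaleDr L2scaleDl.

Lemma L2classZ a (f : L2fun) : L2class (a *: f) = a *: L2class f.
Proof. by rewrite -[RHS]/(L2scale _ _) L2scale_class. Qed.

End SquareIntegrable.

Section TimeFrequencyShifts.
Variable R : realType.
Local Notation mu := (@lebesgue_measure R).
Local Notation L2fun := (L2fun R).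
Local Notation L2 := (L2 R).

(* e^{i theta} *)
Definition expi (theta : R) : R[i] := cos theta +i* sin theta.

Definition modulation_fun (x : R) (f : R -> R[i]) : R -> R[i] :=
  fun t => expi (2 * pi * x * t) * f t.

Definition translation_fun (y : R) (f : R -> R[i]) : R -> R[i] :=
  fun t => f (t - y).

Lemma normc_expi theta : Normc.normc (expi theta) = 1.
Proof. by rewrite /expi /= cos2Dsin2 sqrtr1. Qed.

Lemma modulation_fun_L2 x (f : L2fun) : modulation_fun x f \in @L2_pred R.
Proof.
have /L2_predP[mf sf] := L2fun_mem f; apply/L2_predP; split.
  have mxt : measurable_fun [set: R] (fun t => 2 * pi * x * t).
    exact: measurable_funM.
  have mcos : measurable_fun [set: R] (@cos R).
    by apply: continuous_measurable_fun; exact: continuous_cos.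
  have msin : measurable_fun [set: R] (@sin R).
    by apply: continuous_measurable_fun; exact: continuous_sin.
  apply: cmeasurableM mf; split.
    exact: measurableT_comp mcos mxt.
  exact: measurableT_comp msin mxt.
move: sf; rewrite /sqintegrable; congr (_ < _)%E; apply: eq_integral => t _.
by rewrite Normc.normcM normc_expi mul1r.
Qed.

Lemma lebesgue_measureB (y : R) (A : set R) : measurable A ->
  pushforward mu (fun t => t - y : measurableTypeR R) A = mu A.
Proof.
have mB : measurable_fun [set: measurableTypeR R]
    (fun t => t - y : measurableTypeR R) by exact: measurable_funB.
pose m : {mfun measurableTypeR R >-> measurableTypeR R} :=
  HB.pack (fun t => t - y : measurableTypeR R) (isMeasurableFun.Build _ _ _ _ _ mB).
move=> mA.
apply/esym/(@lebesgue_measure_unique R (pushforward mu m)) => // _ [[a b]] _ <-.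
rewrite -[RHS]/(mu ((fun t => t - y) @^-1` `]a, b]%classic)).
rewrite (_ : _ @^-1` _ = `]a + y, b + y]%classic); last first.
  by apply/seteqP; split=> t /=; rewrite !in_itv/= ltrBrDr lerBlDr.
rewrite !lebesgue_measure_itv/= !lte_fin ltrD2r.
by case: ifPn => // _; rewrite -!EFinB; congr EFin; ring.
Qed.

Lemma translation_fun_L2 y (f : L2fun) : translation_fun y f \in @L2_pred R.
Proof.
have /L2_predP[mf sf] := L2fun_mem f; apply/L2_predP.
have mB : measurable_fun [set: R] (fun t => t - y) by exact: measurable_funB.
split.
  by split; [apply: measurableT_comp mf.1 mB | apply: measurableT_comp mf.2 mB].
move: sf; rewrite /sqintegrable; congr (_ < _)%E.
have := @ge0_integral_pushforward _ _ (measurableTypeR R) (measurableTypeR R) R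
  (fun t : R => t - y) mB mu setT (fun t : R => (Normc.normc (f t) ^+ 2)%:E)
  measurableT (cmeasurable_normc_sqr mf).
rewrite preimage_setT => <-; last by move=> t _; rewrite lee_fin sqr_ge0.
by apply: eq_measure_integral => A mA _; exact/esym/lebesgue_measureB.
Qed.

Lemma ae_translation y (P : R -> Prop) :
  (\forall t \ae mu, P t) -> \forall t \ae mu, P (t - y).
Proof.
move=> [N [mN N0 PN]]; exists ((fun t => t - y) @^-1` N); split.
- rewrite -[X in measurable X]setTI.
  have : measurable_fun [set: R] (fun t => t - y) by exact: measurable_funB.
  exact.
- by rewrite -N0; exact: lebesgue_measureB.
- by move=> t /PN.
Qed.

Definition modulation (x : R) (u : L2) : L2 :=
  L2class (MkL2fun (modulation_fun_L2 x (repr u))).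

Definition translation (y : R) (u : L2) : L2 :=
  L2class (MkL2fun (translation_fun_L2 y (repr u))).

(* These operations on classes do not depend on the representative. *)
Lemma modulation_class x (f : L2fun) :
  modulation x (L2class f) = L2class (MkL2fun (modulation_fun_L2 x f)).
Proof.
apply/L2class_eqP.
apply: (@filterS _ _ (ae_filter_ringOfSetsType mu)) (repr_L2class f).
by move=> t /(_ I) ft _; rewrite /= /modulation_fun ft.
Qed.

Lemma translation_class y (f : L2fun) :
  translation y (L2class f) = L2class (MkL2fun (translation_fun_L2 y f)).
Proof.
apply/L2class_eqP.
exact: (ae_translation y (repr_L2class f)).
Qed.

Lemma modulation_is_linear x : linear (modulation x).
Proof.
move=> a u v; rewrite -[u]L2class_repr -[v]L2class_repr -L2classZ -L2classD.
rewrite !modulation_class -L2classZ -L2classD; congr L2class.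
apply/val_inj/funext => t /=.
rewrite -[RHS]/(a * (_ * repr u t) + _ * repr v t).
by rewrite -[LHS]/(_ * (a * repr u t + repr v t)) mulrDr mulrCA.
Qed.

HB.instance Definition _ x := GRing.isLinear.Build R[i] L2 L2 _ (modulation x)
  (modulation_is_linear x).

Lemma translation_is_linear y : linear (translation y).
Proof.
move=> a u v; rewrite -[u]L2class_repr -[v]L2class_repr -L2classZ -L2classD.
rewrite !translation_class -L2classZ -L2classD; congr L2class.
exact/val_inj/funext.
Qed.

HB.instance Definition _ y := GRing.isLinear.Build R[i] L2 L2 _ (translation y)
  (translation_is_linear y).

End TimeFrequencyShifts.

(* Main.v *)
(* The indicator of the cell J = {t | 0 <= t / x < 1} is not in the range.
   If f + c E_y T_x f = 1_J, then h = |f|^2 satisfies h(t) = h(t - x) for almost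
   every t outside J.  The half-line A = {t | 0 <= t / x} is the disjoint union
   of A + x and J, so the integral of h over A equals itself plus the integral
   of h over J; being finite, it forces h = 0 a.e. on J.  The opposite half-line
   similarly gives h = 0 a.e. on J - x.  Hence 1_J = f + c E_y T_x f = 0 a.e. on
   J, although J has positive measure. *)
Require Import Defs.
From mathcomp Require Import all_boot all_order all_algebra.
From mathcomp Require Import all_classical all_reals all_analysis.
From mathcomp Require Import complex.
From mathcomp Require Import measurable_realfun.

Set Implicit Arguments.
Unset Strict Implicit.
Unset Printing Implicit Defensive.

Import Order.TTheory GRing.Theory Num.Theory.

Local Open Scope classical_set_scope.
Local Open Scope ring_scope.
Local Open Scope complex_scope.

(** Change of variables: Lebesgue measure is its own pushforward under [t - x]. *)
Lemma ge0_integral_translation (R : realType) (x : R) (h : R -> \bar R) :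
  measurable_fun [set: R] h -> (forall t, 0 <= h t)%E ->
  (\int[lebesgue_measure]_(t in [set: R]) h (t - x)%R =
   \int[lebesgue_measure]_(t in [set: R]) h t)%E.
Proof.
move=> mh h0.
have mB : measurable_fun [set: R] (fun t => t - x) by exact: measurable_funB.
have := @ge0_integral_pushforward _ _ (measurableTypeR R) (measurableTypeR R) R
  (fun t : R => t - x) mB lebesgue_measure setT h measurableT mh.
rewrite preimage_setT => <-; last by move=> t _; exact: h0.
by apply: eq_measure_integral => A mA _; exact: lebesgue_measureB.
Qed.

(** The common finite integral of [u] and [v] cancels, leaving a nonnegative [w] of integral zero.
    Below, [u] and [v] are translates of each other. *)
Lemma ge0_ae_eq0_of_integralD d (T : measurableType d) (R : realType)
    (mu : {measure set T -> \bar R}) (u v w : T -> \bar R) :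
  measurable_fun [set: T] u -> measurable_fun [set: T] v ->
  measurable_fun [set: T] w ->
  (forall t, 0 <= u t)%E -> (forall t, 0 <= v t)%E -> (forall t, 0 <= w t)%E ->
  (\int[mu]_(t in [set: T]) u t = \int[mu]_(t in [set: T]) v t)%E ->
  (\int[mu]_(t in [set: T]) u t < +oo)%E ->
  (\forall t \ae mu, u t = v t + w t)%E ->
  \forall t \ae mu, w t = 0%E.
Proof.
move=> mu_ mv mw u0 v0 w0 uv ufin uvw.
have : (\int[mu]_(t in [set: T]) u t =
    \int[mu]_(t in [set: T]) v t + \int[mu]_(t in [set: T]) w t)%E.
  rewrite -ge0_integralD//; apply: ge0_ae_eq_integral => //.
  - exact: emeasurable_funD.
  - by move=> t _; exact: adde_ge0.
  - by apply: filterS uvw => t ->.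
rewrite uv => /esym vw.
have w_int0 : (\int[mu]_(t in [set: T]) w t = 0)%E.
  have vfin : (\int[mu]_(t in [set: T]) v t)%E \is a fin_num.
    by rewrite ge0_fin_numE -?uv//; exact: integral_ge0.
  move: vfin vw; case: (\int[mu]_(t in _) v t)%E => // a _.
  case: (\int[mu]_(t in _) w t)%E => // b [].
  by move=> /(canRL (addKr a)) ->; rewrite addNr.
have : ae_eq mu setT w (cst 0%E).
  apply/(ae_eq_integral_abs mu measurableT mw).
  by rewrite -w_int0; apply: eq_integral => t _; rewrite gee0_abs.
by apply: filterS => t; exact.
Qed.

(** The hypothesis makes [h] periodic on each of the half-lines [0 <= t / x] and [t / x < 0]
    separately, which integrability allows only for zero; the conclusion keeps the two cells
    adjacent to the cut. *)
Lemma translation_invariant_ae_eq0 (R : realType) (x : R) (h : R -> \bar R) :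
  x != 0 ->
  measurable_fun [set: R] h -> (forall t, 0 <= h t)%E ->
  (\int[lebesgue_measure]_(t in [set: R]) h t < +oo)%E ->
  (\forall t \ae lebesgue_measure, ~~ (0 <= t / x < 1) -> h t = h (t - x)) ->
  \forall t \ae lebesgue_measure,
    0 <= t / x < 1 -> h t = 0%E /\ h (t - x) = 0%E.
Proof.
move=> x0 mh h0 hfin hinv.
(* In the coordinate [t / x] the shift is by 1, whatever the sign of [x]. *)
have shiftE t : (t - x) / x = t / x - 1 by rewrite mulrBl divff.
have mB : measurable_fun [set: R] (fun t => t - x) by exact: measurable_funB.
have mq : measurable_fun [set: R] (fun t : R => t / x).
  exact: measurable_funM.
have mle : measurable_fun [set: R] (fun t : R => 0 <= t / x).
  exact: measurable_fun_ler.
have mlt (a : R) : measurable_fun [set: R] (fun t : R => t / x < a).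
  exact: measurable_fun_ltr.
have mcell : measurable_fun [set: R] (fun t : R => 0 <= t / x < 1).
  exact: measurable_and.
have mif (b : R -> bool) (k : R -> \bar R) : measurable_fun [set: R] b ->
    measurable_fun [set: R] k ->
    measurable_fun [set: R] (fun t => if b t then k t else 0%E).
  by move=> mb mk; exact: measurable_fun_ifT.
have if_ge0 (b : bool) (e : \bar R) : (0 <= e -> 0 <= if b then e else 0)%E.
  by case: b.
have mhx : measurable_fun [set: R] (fun t => h (t - x)).
  exact: measurableT_comp mh mB.
have if_fin (b : R -> bool) : measurable_fun [set: R] b ->
    (\int[lebesgue_measure]_(t in [set: R]) (if b t then h t else 0) < +oo)%E.
  move=> mb; apply: le_lt_trans hfin; apply: ge0_le_integral => //.
  - by move=> t _; exact: if_ge0.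
  - exact: mif.
  - by move=> t _; case: ifP.
have h_cell : \forall t \ae lebesgue_measure,
    (if 0 <= t / x < 1 then h t else 0%E) = 0%E.
  (* The translate of [k] lives on [1 <= t / x], where it agrees a.e. with [h]; so [k] exceeds it
     exactly by [h] on the cell. *)
  pose k t := if 0 <= t / x then h t else 0%E.
  have mk : measurable_fun [set: R] k by exact: mif.
  have k0 t : (0 <= k t)%E by exact: if_ge0.
  apply: (@ge0_ae_eq0_of_integralD _ (measurableTypeR R) R
    lebesgue_measure k (fun t => k (t - x))) => //.
  - exact: measurableT_comp mk mB.
  - exact: mif.
  - by move=> t; exact: if_ge0.
  - by rewrite ge0_integral_translation.
  - exact: if_fin.
  - apply: (@filterS _ _ (ae_filter_ringOfSetsType _)) hinv => t; rewrite /k shiftE subr_ge0.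
    have [t0|t0] := leP 0 (t / x); have [t1|t1] := leP 1 (t / x) => /= E.
    + by rewrite adde0 E.
    + by rewrite add0e.
    + by move: (le_lt_trans t1 t0); rewrite ltr10.
    + by rewrite adde0.
have hx_cell : \forall t \ae lebesgue_measure,
    (if 0 <= t / x < 1 then h (t - x) else 0%E) = 0%E.
  (* Now the translate is the larger one: it lives on [t / x < 1], and exceeds [k] by [h (t - x)] on
     the cell. *)
  pose k t := if t / x < 0 then h t else 0%E.
  have mk : measurable_fun [set: R] k by exact: mif.
  have k0 t : (0 <= k t)%E by exact: if_ge0.
  apply: (@ge0_ae_eq0_of_integralD _ (measurableTypeR R) R
    lebesgue_measure (fun t => k (t - x)) k) => //.
  - exact: measurableT_comp mk mB.
  - exact: mif.
  - by move=> t; exact: if_ge0.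
  - by rewrite ge0_integral_translation.
  - by rewrite ge0_integral_translation//; exact: if_fin.
  - apply: (@filterS _ _ (ae_filter_ringOfSetsType _)) hinv => t; rewrite /k shiftE subr_lt0.
    have [t0|t0] := leP 0 (t / x); have [t1|t1] := leP 1 (t / x) => /= E.
    + by rewrite adde0.
    + by rewrite add0e.
    + by move: (le_lt_trans t1 t0); rewrite ltr10.
    + by rewrite adde0 E.
by apply: (@filterS2 _ _ (ae_filter_ringOfSetsType _)) h_cell hx_cell => t + + tJ; rewrite tJ.
Qed.

(** The norm of [R[i]] takes its values in [R[i]]; its real part is [normc]. *)
Lemma normc_norm1 (R : realType) (c : R[i]) : `|c| = 1 -> Normc.normc c = 1.
Proof. by move=> /(congr1 (@complex.Re R)). Qed.

Lemma measurable_cell (R : realType) (x : R) :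
  measurable [set t : R | 0 <= t / x < 1].
Proof.
have mq : measurable_fun [set: R] (fun t : R => t / x).
  exact: measurable_funM.
rewrite -[X in measurable X]setTI.
have -> : [set t : R | 0 <= t / x < 1] = (fun t => t / x) @^-1` `[0, 1[.
  by apply/seteqP; split=> t /=; rewrite in_itv.
by apply: mq => //; exact: measurable_itv.
Qed.

Lemma cell_measure_fin (R : realType) (x : R) : x != 0 ->
  (lebesgue_measure [set t : R | (0 <= t / x < 1)%R] < +oo)%E.
Proof.
(* On the cell, [t] is [x] times a factor of modulus at most 1. *)
move=> x0; apply: (@le_lt_trans _ _ (lebesgue_measure `[- `|x|, `|x|])).
  apply: le_measure; rewrite ?inE//; first exact: measurable_cell.
  move=> t /= /andP[t0 t1]; rewrite in_itv/= -ler_norml -[t](divfK x0) normrM.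
  by rewrite ler_piMl// ger0_norm// ltW.
by rewrite lebesgue_measure_itv/=; case: ifP => _; rewrite -?EFinB ltry.
Qed.

Lemma cell_measure_neq0 (R : realType) (x : R) : x != 0 ->
  lebesgue_measure [set t : R | (0 <= t / x < 1)%R] <> 0%E.
Proof.
move=> x0 J0.
(* The open interval between 0 and [x] serves both signs: the cell contains the endpoint 0, which is
   on the left or on the right according to the sign of [x]. *)
have : (lebesgue_measure `](Num.min 0 x)%R, (Num.max 0 x)%R[ <=
    lebesgue_measure [set t : R | (0 <= t / x < 1)%R])%E.
  apply: le_measure; rewrite ?inE//; first exact: measurable_cell.
  move=> t; rewrite /= in_itv/=; have [xlt|xgt|/eqP] := ltgtP x 0.
  - rewrite ler_ndivlMr// ltr_ndivrMr// mul0r mul1r.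
    by move=> /andP[-> /ltW ->].
  - rewrite ler_pdivlMr// ltr_pdivrMr// mul0r mul1r.
    by move=> /andP[/ltW -> ->].
  - by rewrite (negbTE x0).
apply/negP; rewrite -ltNge J0 lebesgue_measure_itv/= lte_fin.
have [xlt|xgt|/eqP] := ltgtP x 0.
- by rewrite xlt -EFinB lte_fin subr_gt0.
- by rewrite xgt -EFinB lte_fin subr_gt0.
- by rewrite (negbTE x0).
Qed.

Lemma indicator_L2 (R : realType) (J : set R) :
  measurable J -> (lebesgue_measure J < +oo)%E ->
  (fun t => (\1_J t : R)%:C) \in @L2_pred R.
Proof.
move=> mJ Jfin; apply/L2_predP; split.
  by split=> /=; [exact: measurable_indic | exact: measurable_cst].
rewrite /sqintegrable; under eq_integral => t _.
  rewrite normc_sqr /= expr0n addr0.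
  have -> : (\1_J t : R) ^+ 2 = \1_J t.
    by rewrite indicE; case: (_ \in _); rewrite ?expr1n ?expr0n.
  over.
by rewrite integral_indic// setIT.
Qed.

Theorem theorem3p3 (R : realType) (x y : R) (c : R[i]) :
  x != 0 -> x * y \is a Num.int -> `|c| = 1 ->
  ~ set_surj [set: L2 R] [set: L2 R]
      (idfun \+ c \*: (modulation y \o translation x)).
Proof.
move=> x0 _ c1 surj.
pose J := [set t : R | 0 <= t / x < 1].
have gL2 := indicator_L2 (measurable_cell x) (cell_measure_fin x0).
have [u _] := surj (L2class (MkL2fun gL2)) I.
(* With a representative [f], the equation in [L2] becomes an a.e. equation between functions. *)
rewrite -[u]L2class_repr; set f := repr u.
rewrite -[LHS]/(L2class f + c *: modulation y (translation x (L2class f))).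
rewrite translation_class modulation_class -L2classZ -L2classD.
move=> /L2class_eqP; rewrite -/J => fE.
have /L2_predP[mf sf] := L2fun_mem f.
have {}fE : \forall t \ae lebesgue_measure,
    f t + c * (expi (2 * pi * y * t) * f (t - x)) = (\1_J t : R)%:C.
  by apply: (@filterS _ _ (ae_filter_ringOfSetsType _)) fE => t /(_ I).
have f0 : \forall t \ae lebesgue_measure, 0 <= t / x < 1 ->
    (Normc.normc (f t) ^+ 2)%:E = 0%E /\ (Normc.normc (f (t - x)) ^+ 2)%:E = 0%E.
  apply: (@translation_invariant_ae_eq0 R x
    (fun t => (Normc.normc (f t) ^+ 2)%:E)) => //.
  - exact: cmeasurable_normc_sqr.
  - by move=> t; rewrite lee_fin sqr_ge0.
  (* Off [J] the two terms are opposite, and [c] and [expi] have modulus 1, so [f t] and [f (t - x)]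
     have equal moduli. *)
  apply: (@filterS _ _ (ae_filter_ringOfSetsType _)) fE => t + tJ; rewrite indicE memNset; last exact/negP.
  move=> /eqP; rewrite addr_eq0 => /eqP ->.
  by rewrite normcN !Normc.normcM normc_expi (normc_norm1 c1) !mul1r.
apply: (cell_measure_neq0 x0); apply: measure_negligible.
  exact: measurable_cell.
(* Negligibility of [J] means that almost every [t] avoids [J]; at a point of [J] the equation would
   read 0 = 1. *)
rewrite -[X in _.-negligible X]setCK.
apply: (@filterS2 _ _ (ae_filter_ringOfSetsType _)) fE f0 => t + + /= tJ => + /(_ tJ)[[ft] [fxt]].
have normc0 z : Normc.normc z ^+ 2 = 0 -> z = 0 :> R[i].
  by move=> /eqP; rewrite expf_eq0 /= => /eqP /Normc.eq0_normc.
rewrite (normc0 _ ft) (normc0 _ fxt) !mulr0 addr0 indicE mem_set// => /eqP.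
by rewrite eq_sym (oner_eq0 R[i]).
Qed.
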